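(* Let $G$ be a connected graph on $n$ vertices with maximum degree $\Delta$, let $x$ be any vertex of $G$, and let $k\ge 1$ be an integer with $2k<n$. Let $\gamma_x^{2k}=(x=X_0,X_1,\ldots,X_{2k})$ be a simple random walk of length $2k$ on $G$ started at $x$. Then for every real $s>0$ with $s\le \frac14\left(\frac{k}{\Delta^7\log\Delta}\right)^{1/5}$, $$\mathbb{P}\left(\mathrm{support}(\gamma_x^{2k})\le s\ \middle|\ X_{2k}=X_0\right)\le \exp\left(-\frac{k}{65\,\Delta^7 s^4}\right).$$
   Context: Graphs are finite, undirected, and may have multiedges and self-loops; the degree of a vertex is the corresponding row sum of the adjacency matrix (each self-loop contributes one). The simple random walk moves at each step along a uniformly random edge incident to the current vertex, i.e. from $u$ to $w$ with probability $A(u,w)/\deg(u)$, where $A$ is the adjacency matrix with entries counting edges. $\mathrm{support}(\gamma)$ is the number of distinct vertices visited by the walk $\gamma$. $\log$ is the natural logarithm. *)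

(* Defs.v *)
From HB Require Import structures.
From mathcomp Require Import all_boot all_order all_algebra.
From mathcomp Require Import reals.

Set Implicit Arguments.
Unset Strict Implicit.
Unset Printing Implicit Defensive.

Import Order.TTheory GRing.Theory Num.Theory.
Local Open Scope ring_scope.

(* Each edge is mapped to the set of its endpoints: two vertices for an
   ordinary edge, a single one for a self-loop.  Since [ends] need not be
   injective, multiple edges are allowed. *)
Record multigraph (V : finType) := Multigraph {
  edge : finType;
  ends : edge -> {set V};
  ends_card : forall e, (0 < #|ends e| <= 2)%N
}.

Section Graph.
Variables (V : finType) (G : multigraph V).

(* [set u; u] = [set u], so [adj u u] is the number of self-loops at [u]. *)
Definition adj (u w : V) : nat := #|[set e : edge G | ends e == [set u; w]]|.

Definition deg (u : V) : nat := (\sum_(w : V) adj u w)%N.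

Definition max_degree : nat := (\max_(u : V) deg u)%N.

Definition connected : Prop :=
  forall u w : V, connect (fun a b => 0 < adj a b)%N u w.

End Graph.

Section RandomWalk.
Variables (R : realType) (V : finType) (G : multigraph V).

Definition step_prob (u w : V) : R := (adj G u w)%:R / (deg G u)%:R.

Fixpoint path_prob (x : V) (p : seq V) : R :=
  if p is y :: p' then step_prob x y * path_prob y p' else 1.

(* Law of the trajectory (X_0, ..., X_m) with X_0 = x: the trajectories are
   the sequences x :: t, with t = (X_1, ..., X_m). *)
Definition walk_prob (x : V) (m : nat) (E : pred (seq V)) : R :=
  \sum_(t : m.-tuple V | E (x :: t)) path_prob x t.

Definition walk_cond_prob (x : V) (m : nat) (E F : pred (seq V)) : R :=
  walk_prob x m [predI E & F] / walk_prob x m F.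

Definition support_size (g : seq V) : nat := #|[set v | v \in g]|.

Lemma walk_probT (x : V) (m : nat) :
  (forall u, 0 < deg G u)%N -> walk_prob x m predT = 1.
Proof.
move=> deg_gt0; rewrite /walk_prob; elim: m x => [|m IHm] x.
  rewrite (eq_bigr (fun=> 1)) => [|t _]; last by rewrite tuple0.
  by rewrite sumr_const card_tuple expn0.
rewrite (reindex (fun yt : V * m.-tuple V => [tuple of yt.1 :: yt.2])) /=.
  rewrite -(pair_bigA _ (fun y (t : m.-tuple V) =>
     step_prob x y * path_prob y t)) /=.
  under eq_bigr => y _ do rewrite -mulr_sumr IHm mulr1.
  rewrite -mulr_suml -natr_sum divff // pnatr_eq0 -lt0n; exact: deg_gt0.
exists (fun t : m.+1.-tuple V => (thead t, [tuple of behead t])).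
  by move=> [y t] _ /=; congr pair; apply: val_inj.
by move=> t _ /=; apply: val_inj; case/tupleP: t.
Qed.

End RandomWalk.

(* Main.v *)
Require Import Defs.
From HB Require Import structures.
From mathcomp Require Import all_boot all_order all_algebra.
From mathcomp Require Import reals sequences exp.
From mathcomp Require Import ring lra zify.

Set Implicit Arguments.
Unset Strict Implicit.
Unset Printing Implicit Defensive.

Import Order.TTheory GRing.Theory Num.Theory.
Local Open Scope ring_scope.

(* Let P be the transition operator, self-adjoint for the degree-weighted inner
   product, and let S be a connected set of at most m vertices containing x.
   With D the maximum degree, adding a small constant on the closed
   neighborhood T of S to a function supported on S leaves its Dirichlet energy
   almost unchanged but increases its norm.  As the energy of a function on S
   with maximum 1 is at least 1/(2m), by Cauchy-Schwarz along a path leaving S,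
   the top of the spectrum of P restricted to T exceeds that of P restricted to
   S by a gap of at least 1/(32 D^3 m^4).

   On the other hand the top of the spectrum on T, raised to the power 2k, is at
   most the sum over y in T of the return probabilities P^(2k)(y, y), each of
   which is at most a power D^O(m) of D times q = P^(2k)(x, x).  So the
   probability that the walk returns to x without leaving S is at most
   D^O(m) q exp(- 2k gap).  Finally S is visited by a walk of length at most 2m
   around a spanning tree, so there are only D^O(m) sets S to sum over, and the
   hypothesis on s absorbs the factors D^O(m). *)

(** * Operators self-adjoint for a weighted inner product *)

Section ReversibleKernel.
Variables (R : realFieldType) (V : finType) (w : V -> R).

Definition ip (f g : V -> R) : R := \sum_u w u * (f u * g u).

Definition op (K : V -> V -> R) (f : V -> R) (u : V) : R := \sum_v K u v * f v.

Definition delta (x u : V) : R := (u == x)%:R.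

Definition reversible (K : V -> V -> R) := forall u v, w u * K u v = w v * K v u.

Lemma ipC f g : ip f g = ip g f.
Proof. by apply: eq_bigr => u _; rewrite (mulrC (f u)). Qed.

Lemma ip_deltal x f : ip (delta x) f = w x * f x.
Proof.
rewrite /ip (bigD1 x) //= /delta eqxx mul1r big1 ?addr0 // => u /negbTE ->.
by rewrite mul0r mulr0.
Qed.

Lemma op_delta K x u : op K (delta x) u = K u x.
Proof.
rewrite /op (bigD1 x) //= /delta eqxx mulr1 big1 ?addr0 // => v /negbTE ->.
by rewrite mulr0.
Qed.

Lemma ip_op K f g : ip f (op K g) = \sum_u \sum_v w u * K u v * (f u * g v).
Proof.
apply: eq_bigr => u _; rewrite /op !mulr_sumr; apply: eq_bigr => v _.
by ring.
Qed.

Lemma op_ge0 K f : (forall u v, 0 <= K u v) -> (forall u, 0 <= f u) ->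
  forall u, 0 <= op K f u.
Proof. by move=> K0 f0 u; apply: sumr_ge0 => v _; rewrite mulr_ge0. Qed.

Lemma iter_op_ge0 K f j : (forall u v, 0 <= K u v) -> (forall u, 0 <= f u) ->
  forall u, 0 <= iter j (op K) f u.
Proof. by move=> K0 f0; elim: j => //= j IH u; apply: op_ge0. Qed.

Lemma ler_op K f g : (forall u v, 0 <= K u v) -> (forall u, f u <= g u) ->
  forall u, op K f u <= op K g u.
Proof. by move=> K0 fg u; apply: ler_sum => v _; rewrite ler_wpM2l. Qed.

Lemma ler_iter_op K f g j :
  (forall u v, 0 <= K u v) -> (forall u, f u <= g u) ->
  forall u, iter j (op K) f u <= iter j (op K) g u.
Proof. by move=> K0 fg; elim: j => //= j IH u; apply: ler_op. Qed.

Lemma iter_op_scale K c f j u :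
  iter j (op K) (fun v => c * f v) u = c * iter j (op K) f u.
Proof.
elim: j u => //= j IH u; rewrite [in RHS]/op mulr_sumr.
by apply: eq_bigr => v _; rewrite IH mulrCA.
Qed.

Lemma iter_op_sum K (f : V -> R) j u :
  iter j (op K) f u = \sum_y f y * iter j (op K) (delta y) u.
Proof.
elim: j u => [|j IH] u /=.
  rewrite (bigD1 u) //= /delta eqxx mulr1 big1 ?addr0 // => y.
  by rewrite eq_sym => /negbTE ->; rewrite mulr0.
transitivity (\sum_v K u v * iter j (op K) f v); first by [].
under [LHS]eq_bigr do rewrite IH mulr_sumr.
rewrite exchange_big; apply: eq_bigr => y _ /=; rewrite [in RHS]/op mulr_sumr.
by apply: eq_bigr => v _; ring.
Qed.

Hypothesis w_gt0 : forall u, 0 < w u.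

Lemma ip_ge0 f : 0 <= ip f f.
Proof.
by apply: sumr_ge0 => u _; rewrite mulr_ge0 ?(ltW (w_gt0 u)) // -expr2 sqr_ge0.
Qed.

Lemma ip_cauchy_schwarz f g : ip f g ^+ 2 <= ip f f * ip g g.
Proof.
rewrite -subr_ge0 /ip expr2 !big_distrlr /= -sumrB.
rewrite (eq_bigr (fun u => \sum_v (w u * w v * (f u * g v) ^+ 2
  - w u * w v * (f u * g u * f v * g v)))); last first.
  by move=> u _; rewrite -sumrB; apply: eq_bigr => v _; ring.
set a := \sum_u _.
suff : a + a >= 0 by lra.
rewrite {1}/a exchange_big /a /= -big_split sumr_ge0 // => u _.
rewrite -big_split sumr_ge0 //= => v _.
have -> : w v * w u * (f v * g u) ^+ 2 - w v * w u * (f v * g v * f u * g u) +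
  (w u * w v * (f u * g v) ^+ 2 - w u * w v * (f u * g u * f v * g v)) =
  w u * w v * (f u * g v - f v * g u) ^+ 2 by ring.
by rewrite mulr_ge0 ?sqr_ge0 // mulr_ge0 ?ltW.
Qed.

Section Reversible.
Variables (K : V -> V -> R) (Krev : reversible K).

Lemma ip_op_sym f g : ip f (op K g) = ip (op K f) g.
Proof.
rewrite (ipC (op K f)) !ip_op exchange_big; apply: eq_bigr => u _.
by apply: eq_bigr => v _; rewrite Krev; ring.
Qed.

Lemma ip_iter_op i j f g :
  ip (iter i (op K) f) (iter j (op K) g) = ip f (iter (i + j) (op K) g).
Proof. by elim: i j => //= i IH j; rewrite -ip_op_sym -iterS IH addnS. Qed.

(* Polarization between [h] and [l^-1 * op K h]. *)
Lemma ip_op_contraction l : 0 <= l ->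
  (forall h, `|ip h (op K h)| <= l * ip h h) ->
  forall h, ip (op K h) (op K h) <= l ^+ 2 * ip h h.
Proof.
move=> l0 form h.
have pol c : 4 * c * ip (op K h) (op K h) <=
    2 * l * (ip h h + c ^+ 2 * ip (op K h) (op K h)).
  pose p u := h u + c * op K h u; pose q u := h u - c * op K h u.
  have -> : 4 * c * ip (op K h) (op K h) = ip p (op K p) - ip q (op K q).
    have -> : ip (op K h) (op K h) = 2^-1 *
       (ip h (op K (op K h)) + ip (op K h) (op K h)).
      by rewrite (ip_op_sym h (op K h)); field.
    rewrite !ip_op -big_split /= mulrA mulr_sumr -sumrB; apply: eq_bigr => u _.
    rewrite -big_split /= mulr_sumr -sumrB; apply: eq_bigr => v _.
    by rewrite /p /q; field.
  have -> : 2 * l * (ip h h + c ^+ 2 * ip (op K h) (op K h)) =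
      l * ip p p + l * ip q q.
    rewrite -mulrDr (mulrC 2) -mulrA; congr (l * _).
    rewrite mulrDr /ip !mulr_sumr -!big_split; apply: eq_bigr => u _ /=.
    by rewrite /p /q; ring.
  have := form p; have := form q.
  by rewrite !ler_norml => /andP[? _] /andP[_ ?]; lra.
move: l0; rewrite le_eqVlt => /orP[/eqP l0|l0].
  by have := pol 1; rewrite -l0; lra.
have := pol l^-1.
have li : l * l^-1 = 1 by rewrite mulfV ?gt_eqF.
have li0 : 0 < l^-1 by rewrite invr_gt0.
set a := ip _ _; set b := ip h h => H.
have -> : a = l * (l^-1 * a) by rewrite mulrA li mul1r.
have : 2 * (l^-1 * a) <= 2 * (l * b).
  have -> : 2 * (l * b) = 2 * l * (b + l^-1 ^+ 2 * a) - 2 * (l * l^-1) * (l^-1 * a).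
    ring.
  rewrite li; lra.
by rewrite ler_pM2l // expr2 -mulrA => ?; rewrite ler_wpM2l // ltW.
Qed.

Lemma ip_iter_op_le l h j : 0 <= l ->
  (forall h, `|ip h (op K h)| <= l * ip h h) ->
  ip (iter j (op K) h) (iter j (op K) h) <= l ^+ (2 * j) * ip h h.
Proof.
move=> l0 form; elim: j => [|j IH] /=; first by rewrite muln0 mul1r.
apply: le_trans (ip_op_contraction l0 form _) _.
by rewrite mulnS exprD -mulrA ler_wpM2l // exprn_ge0.
Qed.

(* The squared norms of the iterates form a log-convex sequence. *)
Lemma ip_iter_op_ge r h j : 0 <= r -> r * ip h h <= ip h (op K h) ->
  r ^+ (2 * j) * ip h h <= ip (iter j (op K) h) (iter j (op K) h).
Proof.
move=> r0 rh; pose c j := ip (iter j (op K) h) (iter j (op K) h).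
have c0 i : 0 <= c i by apply: ip_ge0.
have step i : r ^+ 2 * c i <= c i.+1.
  elim: i => [|i IH].
    have [h0|h0] := eqVneq (ip h h) 0.
      by rewrite {1}/c /= h0 mulr0.
    have hp : 0 < ip h h by rewrite lt_neqAle eq_sym h0 ip_ge0.
    rewrite -(ler_pM2l hp).
    apply: le_trans (ip_cauchy_schwarz h (op K h)).
    have -> : ip h h * (r ^+ 2 * c 0%N) = (r * ip h h) ^+ 2 by rewrite /c /=; ring.
    by rewrite lerXn2r // ?nnegrE ?mulr_ge0 ?(le_trans _ rh) ?mulr_ge0 // ltW.
  have cs : c i.+1 ^+ 2 <= c i * c i.+2.
    apply: le_trans (ip_cauchy_schwarz _ _).
    by rewrite /c !ip_iter_op addSnnS.
  have [ci0|ci0] := eqVneq (c i) 0.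
    move: cs; rewrite ci0 mul0r => cs.
    have : c i.+1 ^+ 2 == 0 by rewrite eq_le cs sqr_ge0.
    by rewrite expf_eq0 /= => /eqP ->; rewrite mulr0.
  have cp : 0 < c i by rewrite lt_neqAle eq_sym ci0 c0.
  rewrite -(ler_pM2l cp); apply: le_trans cs.
  by rewrite mulrCA (mulrA (r ^+ 2)) expr2 ler_wpM2r.
rewrite -/(c j); elim: j => [|j IH]; first by rewrite muln0 mul1r.
by apply: le_trans (step j); rewrite mulnS exprD -mulrA ler_wpM2l ?exprn_ge0.
Qed.

(** Self-adjointness splits a return in [2 * j] steps into two halves of [j] steps, which turns
    return probabilities of even length into squared norms. *)
Lemma ip_iter_op_return x j :
  ip (iter j (op K) (delta x)) (iter j (op K) (delta x)) =
  w x * iter (2 * j) (op K) (delta x) x.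
Proof. by rewrite ip_iter_op ip_deltal mul2n -addnn. Qed.

(* Cauchy-Schwarz on the expansion of [g] in the basis of point masses. *)
Lemma ip_iter_op_trace (T : {set V}) g j :
  (forall u, u \notin T -> g u = 0) ->
  ip (iter j (op K) g) (iter j (op K) g) <=
  ip g g * \sum_(y in T) iter (2 * j) (op K) (delta y) y.
Proof.
move=> gT.
pose c y u := iter j (op K) (delta y) u.
have -> : \sum_(y in T) iter (2 * j) (op K) (delta y) y =
    \sum_(y in T) (w y)^-1 * ip (c y) (c y).
  apply: eq_bigr => y _.
  by rewrite ip_iter_op_return mulrA mulVf ?mul1r // gt_eqF.
have cs u : iter j (op K) g u ^+ 2 <=
    ip g g * \sum_(y in T) (w y)^-1 * c y u ^+ 2.
  rewrite iter_op_sum.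
  (* Dividing by the weight makes [ip g b] equal to the iterate of [g] at [u]. *)
  pose b y := if y \in T then (w y)^-1 * c y u else 0.
  have := ip_cauchy_schwarz g b.
  have -> : ip g b = \sum_y g y * iter j (op K) (delta y) u.
    apply: eq_bigr => y _; rewrite /b; case: ifPn => [_|yT].
      by rewrite -/(c y u) mulrCA (mulrA (w y)) mulfV ?mul1r // gt_eqF.
    by rewrite gT // !mul0r mulr0.
  move/le_trans; apply.
  suff -> : ip b b = \sum_(y in T) (w y)^-1 * c y u ^+ 2 by [].
  rewrite big_mkcond; apply: eq_bigr => y _; rewrite /b; case: ifP => _.
    by field; rewrite gt_eqF.
  by rewrite mulr0 mulr0.
have -> : \sum_(y in T) (w y)^-1 * ip (c y) (c y) =
    \sum_u w u * \sum_(y in T) (w y)^-1 * c y u ^+ 2.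
  under [RHS]eq_bigr do rewrite mulr_sumr.
  rewrite exchange_big; apply: eq_bigr => y _ /=; rewrite mulr_sumr.
  by apply: eq_bigr => u _; ring.
rewrite mulr_sumr; apply: ler_sum => u _.
by rewrite [leRHS]mulrCA -expr2 ler_wpM2l // ltW.
Qed.

End Reversible.
End ReversibleKernel.

(** * Counting lazy walks, covering walks and exit paths *)

Section Combinatorics.
Variables (V : finType) (G : multigraph V).

Definition neighbor : rel V := fun a b => (0 < adj G a b)%N.

(** Laziness lets covering walks of various lengths be padded to one fixed length, so that they can
    be counted as tuples; it also makes neighborhoods closed. *)
Definition lazy_neighbor : rel V := fun a b => (a == b) || neighbor a b.

Lemma adjC a b : adj G a b = adj G b a.
Proof. by rewrite /adj setUC. Qed.

Lemma deg_le_max u : (deg G u <= max_degree G)%N.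
Proof. exact: (leq_bigmax u). Qed.

Lemma card_lazy_neighbor u : (#|[set v | lazy_neighbor u v]| <= (max_degree G).+1)%N.
Proof.
have sub : [set v | lazy_neighbor u v] \subset u |: [set v | neighbor u v].
  by apply/subsetP => v; rewrite !inE eq_sym.
apply: leq_trans (subset_leq_card sub) _; rewrite cardsU1.
have : (#|[set v | neighbor u v]| <= max_degree G)%N.
  apply: leq_trans (deg_le_max u).
  rewrite -sum1_card big_mkcond; apply: leq_sum => v _; rewrite inE.
  by rewrite /neighbor; case: posnP.
by case: (_ \notin _) => /= H; rewrite ?add1n ?ltnS // add0n leqW.
Qed.

Lemma card_neighborhood (S : {set V}) :
  (#|\bigcup_(u in S) [set v | lazy_neighbor u v]| <= #|S| * (max_degree G).+1)%N.
Proof.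
rewrite -sum_nat_const; elim/big_rec2: _ => [|u a A _ IH]; first by rewrite cards0.
apply: leq_trans (leq_card_setU _ _) _.
by rewrite leq_add // card_lazy_neighbor.
Qed.

Lemma card_lazy_path L x :
  (\sum_(t : L.-tuple V | path lazy_neighbor x t) 1 <= (max_degree G).+1 ^ L)%N.
Proof.
elim: L x => [|L IH] x.
  by rewrite big_mkcond (eq_bigr (fun=> 1%N)) ?sum1_card ?card_tuple // => t;
    rewrite tuple0.
rewrite (reindex (fun yt : V * L.-tuple V => [tuple of yt.1 :: yt.2])) /=.
  rewrite -(pair_big_dep (lazy_neighbor x) (fun y (t : L.-tuple V) =>
    path lazy_neighbor y t) (fun _ _ => 1%N)) /=.
  apply: (@leq_trans (\sum_(y | lazy_neighbor x y) (max_degree G).+1 ^ L)).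
    by apply: leq_sum => y _.
  rewrite sum_nat_const expnS leq_mul2r; apply/orP; right.
  by rewrite (eq_card (B := [set v | lazy_neighbor x v])) ?card_lazy_neighbor //
    => v; rewrite inE.
exists (fun t : L.+1.-tuple V => (thead t, [tuple of behead t])).
  by move=> [y t] _ /=; congr pair; apply: val_inj.
by move=> t _ /=; apply: val_inj; case/tupleP: t.
Qed.

(* The visited set of a walk is spanned by its first-visit tree; the new walk
   makes a detour [u, v, u] for each first visit of [v] from [u]. *)
Lemma short_covering_path x t : path neighbor x t ->
  exists2 c, path neighbor x c &
    x :: c =i x :: t /\ (size c <= 2 * #|[set v | v \in x :: t]|)%N.
Proof.
elim/last_ind: t => [|t v IH]; first by exists [::].
rewrite rcons_path => /andP[/IH [c pc [ec sc]] uv].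
have memr y : (y \in x :: rcons t v) = (y == v) || (y \in x :: t).
  by rewrite -rcons_cons mem_rcons in_cons.
have [vt|vt] := boolP (v \in x :: t).
  have memt y : (y \in x :: rcons t v) = (y \in x :: t).
    by rewrite memr; case: eqP => // ->; rewrite vt.
  exists c => //; split; first by move=> y; rewrite ec memt.
  suff -> : [set y | y \in x :: rcons t v] = [set y | y \in x :: t] by [].
  by apply/setP => y; rewrite !in_set memt.
have uc : last x t \in x :: c by rewrite ec mem_last.
case/splitPl: uc pc ec sc => c1 c2 u1 pc ec sc.
exists (c1 ++ v :: last x t :: c2).
  move: pc; rewrite !cat_path u1 /= => /andP[-> ->]; rewrite !andbT /=.
  by rewrite uv /neighbor adjC.
split.
  move=> y; rewrite memr -(ec y).
  have : last x t \in x :: c1 by rewrite -u1 mem_last.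
  rewrite !(in_cons, mem_cat); case: (y =P last x t) => [->|_].
    by move=> /orP[] ->; rewrite !orbT.
  by move=> _; case: (y == x); case: (y \in c1); case: (y == v); case: (y \in c2).
have -> : [set y | y \in x :: rcons t v] = v |: [set y | y \in x :: t].
  by apply/setP => y; rewrite in_setU1 !in_set memr.
rewrite cardsU1 in_set vt mulnDr; move: sc; rewrite !size_cat /= => sc.
by rewrite !addnS muln1 !add2n !ltnS.
Qed.

Lemma lazy_covering_path x t m : path neighbor x t ->
  (#|[set v | v \in x :: t]| <= m)%N ->
  exists2 c : (2 * m).-tuple V, path lazy_neighbor x c & x :: c =i x :: t.
Proof.
move=> /short_covering_path [c pc [ec sc]] tm.
have cm : (size c <= 2 * m)%N by apply: leq_trans sc _; rewrite leq_mul2l.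
have sz : size (c ++ nseq (2 * m - size c) (last x c)) == (2 * m)%N.
  by rewrite size_cat size_nseq subnKC.
exists (Tuple sz) => /=.
  rewrite cat_path; apply/andP; split.
    by apply: sub_path pc => a b; rewrite /lazy_neighbor => ->; rewrite orbT.
  by elim: (_ - _)%N => //= i ->; rewrite /lazy_neighbor eqxx.
move=> y; rewrite -ec -cat_cons mem_cat mem_nseq.
by case: (y =P last x c) => [->|]; rewrite ?mem_last // andbF orbF.
Qed.

(** A simple path to a vertex outside [S] is cut just after its first exit. The vertices before the
    exit are distinct elements of [S], which bounds the length. *)
Lemma exit_path (S : {set V}) u : connected G -> (#|S| < #|V|)%N -> u \in S ->
  exists p, [/\ path neighbor u p, uniq (u :: p), last u p \notin S &
    (size p <= #|S|)%N].
Proof.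
move=> conn SV uS.
have [z zS] : exists z, z \notin S.
  apply/existsP; rewrite -negb_forall; apply/negP => /forallP all.
  move: SV; rewrite -cardsT.
  suff -> : S = setT by rewrite ltnn.
  by apply/setP => y; rewrite all inE.
have /connectP [p0 pp0 ez] := conn u z.
move: zS; rewrite ez; case/shortenP: pp0 => p pp up _ lS {p0 ez}.
have hp : has (fun v => v \notin S) p.
  apply/hasP; exists (last u p) => //.
  by have := mem_last u p; rewrite inE => /orP[/eqP e|//]; move: lS; rewrite e uS.
pose i := find (fun v => v \notin S) p.
have ip : (i < size p)%N by rewrite -has_find.
have tE : take i.+1 p = rcons (take i p) (nth u p i) by apply: take_nth.
exists (take i.+1 p); split.
- by move: pp; rewrite -[in X in X -> _](cat_take_drop i.+1 p) cat_path => /andP[].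
- exact: (take_uniq i.+2 up).
- by rewrite tE last_rcons; apply: (@nth_find _ u (fun v => v \notin S)).
rewrite tE size_rcons.
have /card_uniqP : uniq (u :: take i p) by apply: (take_uniq i.+1 up).
rewrite /= => <-; apply: subset_leq_card; apply/subsetP => y.
rewrite inE => /orP[/eqP -> //|].
case/(nthP u) => j; rewrite size_takel; last exact: ltnW.
move=> ji <-; rewrite nth_take //.
by have := before_find u ji; move/negbFE.
Qed.

End Combinatorics.

(** * Iterated kernels as sums over walks, and the union bound *)

Section Walks.
Variables (R : realType) (V : finType) (G : multigraph V).

Local Notation P := (step_prob R G).

(** The substochastic kernel of the walk killed on leaving [S]. *)
Definition restricted_step (S : {set V}) (u v : V) : R :=
  if (u \in S) && (v \in S) then P u v else 0.

Lemma step_ge0 u v : 0 <= P u v.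
Proof. by rewrite divr_ge0. Qed.

Lemma path_prob_ge0 x p : 0 <= path_prob R G x p.
Proof. by elim: p x => //= y p IH x; rewrite mulr_ge0 ?step_ge0. Qed.

Lemma path_prob_neq0 x p : path_prob R G x p != 0 -> path (neighbor G) x p.
Proof.
elim: p x => //= y p IH x; rewrite mulf_eq0 negb_or => /andP[+ /IH ->].
rewrite andbT /step_prob mulf_eq0 negb_or => /andP[+ _].
by rewrite pnatr_eq0 -lt0n.
Qed.

Lemma iter_restricted_step (S : {set V}) x u j : u \in S ->
  iter j (op (restricted_step S)) (delta R x) u =
  \sum_(t : j.-tuple V | all (mem S) t && (last u t == x)) path_prob R G u t.
Proof.
elim: j u => [|j IH] u uS.
  rewrite big_mkcond (eq_bigr (fun=> (u == x)%:R)).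
    by rewrite sumr_const card_tuple expn0.
  by move=> t _; rewrite tuple0 /=; case: eqP.
rewrite (reindex (fun yt : V * j.-tuple V => [tuple of yt.1 :: yt.2])) /=.
  under eq_bigl do rewrite -andbA.
  rewrite -(pair_big_dep (mem S) (fun y (t : j.-tuple V) =>
    all (mem S) t && (last y t == x)) (fun y (t : j.-tuple V) =>
     step_prob R G u y * path_prob R G y t)) /=.
  rewrite [LHS](_ : _ = \sum_y restricted_step S u y *
    iter j (op (restricted_step S)) (delta R x) y) // [RHS]big_mkcond.
  apply: eq_bigr => y _; rewrite /restricted_step uS /=; case: ifP => yS.
    by rewrite IH // mulr_sumr.
  by rewrite mul0r.
exists (fun t : j.+1.-tuple V => (thead t, [tuple of behead t])).
  by move=> [y t] _ /=; congr pair; apply: val_inj.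
by move=> t _ /=; apply: val_inj; case/tupleP: t.
Qed.

Lemma iter_step x u j :
  iter j (op P) (delta R x) u =
  \sum_(t : j.-tuple V | last u t == x) path_prob R G u t.
Proof.
have opE f v : op (restricted_step [set: V]) f v = op P f v.
  by apply: eq_bigr => y _; rewrite /restricted_step !inE.
have -> : iter j (op P) (delta R x) u =
    iter j (op (restricted_step [set: V])) (delta R x) u.
  elim: j u => //= j IH u; rewrite opE; apply: eq_bigr => y _.
  by rewrite IH.
rewrite iter_restricted_step ?inE //; apply: eq_bigl => t.
by rewrite (_ : all _ _) //; apply/allP => y _; rewrite /= inE.
Qed.

Lemma nth_last_walk (x : V) j (t : j.-tuple V) : nth x (x :: t) j = last x t.
Proof. by rewrite -[last x t]/(last x (x :: t)) (last_nth x) /= size_tuple. Qed.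

Lemma closed_walk_prob x k :
  walk_prob R G x (2 * k) (fun g => nth x g (2 * k) == nth x g 0) =
  iter (2 * k) (op P) (delta R x) x.
Proof.
rewrite iter_step; apply: eq_bigl => t.
by rewrite nth_last_walk.
Qed.

(** The union runs over lazy walks [t] instead of sets: the visited set of each relevant walk is
    also that of some [t], and overcounting is harmless for an upper bound. *)
Lemma small_support_union_bound x k m (E : pred (seq V)) c :
  (forall g, E g -> (support_size g <= m)%N) -> 0 <= c ->
  (forall t : (2 * m).-tuple V, path (lazy_neighbor G) x t ->
    (#|[set v | v \in x :: t]| <= m)%N ->
    iter (2 * k) (op (restricted_step [set v | v \in x :: t])) (delta R x) x <= c) ->
  walk_prob R G x (2 * k)
    [predI E & fun g => nth x g (2 * k) == nth x g 0] <=
  ((max_degree G).+1 ^ (2 * m))%:R * c.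
Proof.
move=> Em c0 bnd.
pose F (g : (2 * k).-tuple V) (t : (2 * m).-tuple V) :=
  [&& path (lazy_neighbor G) x t, (#|[set v | v \in x :: t]| <= m)%N &
    all (mem [set v | v \in x :: t]) g && (last x g == x)].
apply: (@le_trans _ _ (\sum_(g : (2 * k).-tuple V)
    \sum_(t : (2 * m).-tuple V | F g t) path_prob R G x g)).
  rewrite /walk_prob big_mkcond; apply: ler_sum => g _.
  have nn : 0 <= \sum_(t : (2 * m).-tuple V | F g t) path_prob R G x g.
    by apply: sumr_ge0 => t _; apply: path_prob_ge0.
  case: ifPn => // /andP[/= /Em gm gx].
  have {}gx : last x g == x by rewrite -(nth_last_walk x g).
  (* A sequence of positive probability follows edges, so it has a covering walk. *)
  have [p0|/path_prob_neq0 pg] := eqVneq (path_prob R G x g) 0.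
    by rewrite {1}p0.
  have [t pt et] := lazy_covering_path pg gm.
  have Ft : F g t.
    apply/and3P; split => //.
      by rewrite (eq_card (B := [set v | v \in x :: g])) // => v; rewrite !in_set et.
    rewrite gx andbT; apply/allP => y yg.
    by rewrite /= in_set et inE yg orbT.
  rewrite (bigD1 t) //= lerDl.
  by apply: sumr_ge0 => t' _; apply: path_prob_ge0.
(* For fixed [t], the sum over [g] is the probability of returning to [x] without leaving the
   visited set of [t]. *)
rewrite (exchange_big_dep (fun t : (2 * m).-tuple V =>
  path (lazy_neighbor G) x t && (#|[set v | v \in x :: t]| <= m)%N)) /=; last first.
  by move=> g t _ /and3P[-> ->].
apply: (@le_trans _ _ (\sum_(t : (2 * m).-tuple V | path (lazy_neighbor G) x t) c)).
  rewrite big_mkcondr; apply: ler_sum => t pt; case: ifP => // tm.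
  apply: le_trans (bnd t pt tm).
  rewrite iter_restricted_step ?inE ?eqxx //.
  by under eq_bigl do rewrite /F pt tm /=.
rewrite sumr_const -[leLHS]mulr_natl ler_wpM2r // ler_nat -sum1_card.
exact: card_lazy_path.
Qed.

End Walks.

(** * Dirichlet energy and comparison of return probabilities *)

Section Dirichlet.
Variables (R : realType) (V : finType) (G : multigraph V).
Hypothesis deg_gt0 : forall u, (0 < deg G u)%N.

Local Notation P := (step_prob R G).
Local Notation w := (fun u : V => (deg G u)%:R : R).
Local Notation ret k y := (iter (2 * k) (op P) (delta R y) y).

(** The sum is over ordered pairs, so an edge between distinct vertices counts twice; hence the
    factor 2 in [energyE]. *)
Definition energy (f : V -> R) : R :=
  \sum_u \sum_v (adj G u v)%:R * (f u - f v) ^+ 2.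

Lemma degR_gt0 u : 0 < (deg G u)%:R :> R.
Proof. by rewrite ltr0n. Qed.

Lemma deg_step u v : (deg G u)%:R * P u v = (adj G u v)%:R.
Proof. by rewrite mulrC divfK // gt_eqF ?degR_gt0. Qed.

Lemma step_reversible : reversible w P.
Proof. by move=> u v; rewrite !deg_step adjC. Qed.

Lemma restricted_step_reversible S : reversible w (restricted_step R G S).
Proof.
move=> u v; rewrite /restricted_step andbC; case: ifP => _; last by rewrite !mulr0.
exact: step_reversible.
Qed.

Lemma ip_step f g : ip w f (op P g) = \sum_u \sum_v (adj G u v)%:R * (f u * g v).
Proof.
rewrite ip_op; apply: eq_bigr => u _; apply: eq_bigr => v _.
by rewrite deg_step.
Qed.

(** The case [c = -1] is the energy; the signs of the cases [c = 1] and [c = -1] together place the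
    spectrum of [P] in [[-1, 1]]. *)
Lemma sum_adj_sqr f c :
  \sum_u \sum_v (adj G u v)%:R * (f u + c * f v) ^+ 2 =
  (1 + c ^+ 2) * ip w f f + 2 * c * ip w f (op P f).
Proof.
have e1 : ip w f f = \sum_u \sum_v (adj G u v)%:R * f u ^+ 2.
  apply: eq_bigr => u _; rewrite -mulr_suml /= /deg natr_sum.
  by rewrite -expr2.
have e2 : ip w f f = \sum_u \sum_v (adj G u v)%:R * f v ^+ 2.
  rewrite e1 exchange_big; apply: eq_bigr => u _; apply: eq_bigr => v _.
  by rewrite adjC.
rewrite mulrDl mul1r {1}e1 e2 ip_step !mulr_sumr -!big_split /=.
apply: eq_bigr => u _; rewrite !mulr_sumr -!big_split /=.
by apply: eq_bigr => v _; ring.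
Qed.

Lemma energyE f : energy f = 2 * (ip w f f - ip w f (op P f)).
Proof.
have -> : energy f = \sum_u \sum_v (adj G u v)%:R * (f u + -1 * f v) ^+ 2.
  by apply: eq_bigr => u _; apply: eq_bigr => v _; rewrite mulN1r.
by rewrite sum_adj_sqr; ring.
Qed.

Lemma ip_step_le f : `|ip w f (op P f)| <= 1 * ip w f f.
Proof.
have nn c : 0 <= \sum_u \sum_v (adj G u v)%:R * (f u + c * f v) ^+ 2.
  by apply: sumr_ge0 => u _; apply: sumr_ge0 => v _; rewrite mulr_ge0 ?sqr_ge0.
have := nn 1; have := nn (-1); rewrite !sum_adj_sqr => ? ?.
by rewrite ler_norml; apply/andP; split; lra.
Qed.

Lemma ret_ge0 k y : 0 <= ret k y.
Proof.
by apply: iter_op_ge0 => // u v; apply: step_ge0.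
Qed.

(** Up to the weight of [y], these are squared norms of successive iterates of a contraction. *)
Lemma ret_nonincreasing k y : ret k.+1 y <= ret k y.
Proof.
rewrite -(ler_pM2l (degR_gt0 y)).
rewrite -!(ip_iter_op_return step_reversible) /=.
apply: le_trans (ip_op_contraction step_reversible ler01 ip_step_le _) _.
by rewrite expr1n mul1r.
Qed.

Lemma step_prob_ge u v : neighbor G u v -> (max_degree G)%:R^-1 <= P u v.
Proof.
move=> uv; apply: (@le_trans _ _ (deg G u)%:R^-1).
  by rewrite lef_pV2 ?posrE ?degR_gt0 ?ler_nat ?deg_le_max // ltr0n
     (leq_trans (deg_gt0 u)) // deg_le_max.
by rewrite ler_peMl ?invr_ge0 // ler1n.
Qed.

Lemma max_degree_ge1 (u : V) : 1 <= (max_degree G)%:R :> R.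
Proof. by rewrite ler1n (leq_trans (deg_gt0 u)) // deg_le_max. Qed.

Lemma op_step_ge f u v : (forall z, 0 <= f z) -> P u v * f v <= op P f u.
Proof.
move=> f0; rewrite /op (bigD1 v) //= lerDl.
by apply: sumr_ge0 => z _; rewrite mulr_ge0 ?step_ge0.
Qed.

(** One way to return to [x] is to step to [y], return to [y] in [2 * k] steps and step back, and
    each of the two extra steps costs at most a factor [D]. Monotonicity gives up two steps at [y]
    to make room for them. *)
Lemma ret_neighbor k x y : neighbor G x y ->
  ret k.+1 y <= (max_degree G)%:R ^+ 2 * ret k.+1 x.
Proof.
move=> xy; apply: le_trans (ret_nonincreasing k y) _.
set D : R := (max_degree G)%:R.
have D0 : 0 < D by apply: lt_le_trans (max_degree_ge1 x).
have yx : neighbor G y x by rewrite /neighbor adjC.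
rewrite -ler_pdivrMl ?exprn_gt0 //.
have -> : ret k.+1 x = op P (iter (2 * k) (op P) (op P (delta R x))) x.
  by rewrite mulnS addnC addn2 iterS iterSr.
have nn z : 0 <= iter (2 * k) (op P) (op P (delta R x)) z.
  apply: iter_op_ge0 => [u v|u]; first exact: step_ge0.
  by rewrite op_delta step_ge0.
apply: le_trans (op_step_ge x y nn).
have lb z : P y x * delta R y z <= op P (delta R x) z.
  rewrite op_delta /delta; case: eqP => [->|_]; first by rewrite mulr1.
  by rewrite mulr0 step_ge0.
have -> : (D ^+ 2)^-1 * ret k y = D^-1 * (D^-1 * ret k y).
  by rewrite expr2 invfM mulrA.
apply: ler_pM; rewrite ?invr_ge0 ?mulr_ge0 ?ret_ge0 ?invr_ge0 ?(ltW D0) //.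
  exact: step_prob_ge.
apply: le_trans (ler_iter_op _ _ lb y); last by move=> u v; apply: step_ge0.
by rewrite iter_op_scale ler_wpM2r ?ret_ge0 // step_prob_ge.
Qed.

Lemma ret_lazy_path k x t y : path (lazy_neighbor G) x t -> y \in x :: t ->
  ret k.+1 y <= (max_degree G)%:R ^+ (2 * size t) * ret k.+1 x.
Proof.
have D1 := max_degree_ge1 x.
elim: t x => [|z t IH] x.
  by rewrite inE => _ /eqP ->; rewrite muln0 mul1r.
rewrite [path _ _ _]/= => /andP[xz pt]; rewrite in_cons => /orP[/eqP ->|yt].
  by rewrite ler_peMl ?ret_ge0 // exprn_ege1.
apply: le_trans (IH _ pt yt) _.
rewrite [size (z :: t)]/= (mulnS 2 (size t)) (addnC 2) exprD -[leRHS]mulrA.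
rewrite ler_wpM2l ?exprn_ge0 ?(le_trans _ D1) //.
case/orP: xz => [/eqP ->|/ret_neighbor //].
by rewrite ler_peMl ?ret_ge0 // exprn_ege1.
Qed.

(** Log-convexity bounds the squared norm of the [k]-th iterate of [g] below by the [2 * k]-th power
    of its Rayleigh quotient, while the trace bounds it above. *)
Lemma rayleigh_le (T : {set V}) k r g : 0 <= r -> (0 < k)%N ->
  \sum_(y in T) ret k y <= r ^+ (2 * k) ->
  (forall u, u \notin T -> g u = 0) ->
  ip w g (op P g) <= r * ip w g g.
Proof.
move=> r0 k0 tr gT.
have [g0|g0] := eqVneq (ip w g g) 0.
  by have := ip_step_le g; rewrite g0 !mulr0; apply: le_trans; apply: ler_norm.
have gp : 0 < ip w g g by rewrite lt_neqAle eq_sym g0 ip_ge0 //; exact: degR_gt0.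
have [neg|pos] := ltP (ip w g (op P g)) 0.
  by rewrite (le_trans (ltW neg)) // mulr_ge0 // ltW.
pose q := ip w g (op P g) / ip w g g.
have q0 : 0 <= q by rewrite divr_ge0 // ltW.
have qE : q * ip w g g = ip w g (op P g) by rewrite divfK.
have ql : q * ip w g g <= ip w g (op P g) by rewrite qE.
have := ip_iter_op_ge degR_gt0 step_reversible k q0 ql.
move/le_trans/(_ (ip_iter_op_trace degR_gt0 step_reversible k gT)).
rewrite mulrC ler_pM2l // => /le_trans/(_ tr).
rewrite -qE ler_pM2r // => H; rewrite leNgt; apply/negP => rq.
move: H; rewrite leNgt => /negP; apply.
by rewrite ltrXn2r // -lt0n muln_gt0.
Qed.

(** Cauchy-Schwarz along the path, where the edge leaving [a] is absorbed into the whole local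
    energy at [a]. *)
Lemma sqr_diff_path (f : V -> R) u p : path (neighbor G) u p ->
  (f u - f (last u p)) ^+ 2 <= (size p)%:R *
    \sum_(a <- belast u p) \sum_v (adj G a v)%:R * (f a - f v) ^+ 2.
Proof.
elim: p u => [|z p IH] u /=.
  by rewrite subrr expr0n mul0r.
move=> /andP[uz /IH]; rewrite big_cons.
set b := f z - f (last z p); set Sb := \sum_(_ <- _) _; set Sa := \sum_v _.
have aS : (f u - f z) ^+ 2 <= Sa.
  rewrite /Sa (bigD1 z) //= -[leLHS]addr0 lerD //.
    by rewrite ler_peMl ?sqr_ge0 // ler1n.
  by apply: sumr_ge0 => v _; rewrite mulr_ge0 ?sqr_ge0.
have Sb0 : 0 <= Sb.
  by apply: sumr_ge0 => a _; apply: sumr_ge0 => v _; rewrite mulr_ge0 ?sqr_ge0.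
have -> : f u - f (last z p) = (f u - f z) + b by rewrite /b; ring.
move: (f u - f z) aS => a aS bS.
case: (size p) bS => [|n] bS.
  have : b ^+ 2 == 0 by rewrite eq_le sqr_ge0 andbT (le_trans bS) // mul0r.
  rewrite expf_eq0 /= => /eqP ->; rewrite addr0 mul1r; lra.
have n0 : 0 < n.+1%:R :> R by rewrite ltr0n.
rewrite -(ler_pM2l n0) -[n.+2%:R]natr1.
move: (n.+1%:R) n0 bS => N N0 bS.
(* This square gives [N * (a + b) ^+ 2 <= (N + 1) * (N * a ^+ 2 + b ^+ 2)]. *)
have := sqr_ge0 (N * a - b).
have : (N ^+ 2 + N) * a ^+ 2 <= (N ^+ 2 + N) * Sa.
  by rewrite ler_wpM2l // addr_ge0 ?sqr_ge0 ?ltW.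
have : (N + 1) * b ^+ 2 <= (N + 1) * (N * Sb) by rewrite ler_wpM2l // addr_ge0 // ltW.
lra.
Qed.

(** Along an exit path [f] falls from 1 to 0; as the path is simple, each local energy is used at
    most once. *)
Lemma energy_ge (S : {set V}) (f : V -> R) u : connected G -> (#|S| < #|V|)%N ->
  (forall v, v \notin S -> f v = 0) -> f u = 1 ->
  1 <= #|S|%:R * energy f.
Proof.
move=> conn SV fS fu.
have uS : u \in S.
  by apply/negPn/negP => /fS; rewrite fu; apply/eqP; rewrite oner_eq0.
have [p [pp up lS sp]] := exit_path conn SV uS.
have := sqr_diff_path f pp; rewrite (fS _ lS) fu subr0 expr1n.
move/le_trans; apply; apply: ler_pM => //.
- by apply: sumr_ge0 => a _; apply: sumr_ge0 => v _; rewrite mulr_ge0 ?sqr_ge0.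
- by rewrite ler_nat.
have ub : uniq (belast u p).
  by move: up; rewrite lastI rcons_uniq => /andP[].
rewrite big_uniq // big_mkcond; apply: ler_sum => a _; case: ifP => // _.
by apply: sumr_ge0 => v _; rewrite mulr_ge0 ?sqr_ge0.
Qed.

End Dirichlet.

Lemma powR_rootK (R : realType) (a : R) n : 0 <= a -> (0 < n)%N ->
  (a `^ n%:R^-1) ^+ n = a.
Proof.
move=> a0 n0; rewrite -powR_mulrn ?powR_ge0 // -powRrM mulVf ?powRr1 //.
by rewrite pnatr_eq0 -lt0n.
Qed.

(** * Spectral gap between a set and its closed neighborhood *)

Section Gain.
Variables (R : realType) (V : finType) (G : multigraph V).
Hypothesis deg_gt0 : forall u, (0 < deg G u)%N.

Local Notation P := (step_prob R G).
Local Notation w := (fun u : V => (deg G u)%:R : R).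
Local Notation ret k y := (iter (2 * k) (op P) (delta R y) y).

Variables S T : {set V}.
Hypothesis ST : forall u v, u \in S -> lazy_neighbor G u v -> v \in T.

Lemma sub_closed_neighborhood u : u \in S -> u \in T.
Proof. by move=> uS; apply: ST uS _; rewrite /lazy_neighbor eqxx. Qed.

Section Shift.
Variables (f : V -> R) (e : R).
Hypothesis fS : forall u, u \notin S -> f u = 0.
Hypothesis e_ge0 : 0 <= e.

Local Notation g := (fun u => f u + e * (u \in T)%:R).

(* [f] vanishes at both endpoints of an edge leaving [T], so each such edge costs
   exactly [e ^+ 2]. *)
Lemma energy_shift :
  energy G g <= energy G f + 2 * e ^+ 2 * \sum_(u in T) (deg G u)%:R.
Proof.
have e1 : \sum_(u in T) (deg G u)%:R =
    \sum_u \sum_v (adj G u v)%:R * (u \in T)%:R :> R.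
  rewrite big_mkcond; apply: eq_bigr => u _; rewrite -mulr_suml /deg natr_sum.
  by case: (u \in T); rewrite ?mulr1 ?mulr0.
have e2 : \sum_(u in T) (deg G u)%:R =
    \sum_u \sum_v (adj G u v)%:R * (v \in T)%:R :> R.
  rewrite e1 exchange_big; apply: eq_bigr => u _; apply: eq_bigr => v _.
  by rewrite adjC.
rewrite mulrAC mulr_natl mulr2n {1}e1 e2 mulrDl !mulr_suml -!big_split /=.
apply: ler_sum => u _; rewrite !mulr_suml -!big_split /=.
apply: ler_sum => v _.
have [uv|uv] := posnP (adj G u v); first by rewrite uv !mul0r !addr0.
rewrite -!mulrA -!mulrDr ler_wpM2l //.
have tE : true%:R = 1 :> R by [].
have fE : false%:R = 0 :> R by [].
have [uT|uT] := boolP (u \in T); have [vT|vT] := boolP (v \in T);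
  rewrite ?tE ?fE.
- by have := sqr_ge0 e; lra.
- have vS : v \notin S by apply: contra vT => /sub_closed_neighborhood.
  have uS : u \notin S.
    by apply: contra vT => /ST; apply; rewrite /lazy_neighbor /neighbor uv orbT.
  by rewrite (fS vS) (fS uS); lra.
- have uS : u \notin S by apply: contra uT => /sub_closed_neighborhood.
  have vS : v \notin S.
    by apply: contra uT => /ST; apply; rewrite /lazy_neighbor /neighbor adjC uv orbT.
  by rewrite (fS vS) (fS uS); lra.
by lra.
Qed.

(** The cross term [2 * e * f u] dominates [2 * e * f u ^+ 2] because [f u] lies in [[0, 1]]. *)
Lemma ip_shift : (forall u, 0 <= f u <= 1) ->
  (1 + 2 * e) * ip w f f <= ip w g g.
Proof.
move=> f01; rewrite mulr_sumr; apply: ler_sum => u _ /=.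
rewrite mulrCA ler_wpM2l //; have [uT|uT] := boolP (u \in T).
  have /andP[f0 f1] := f01 u.
  have : 0 <= 2 * e * (f u * (1 - f u)).
    by apply: mulr_ge0; apply: mulr_ge0 => //; rewrite subr_ge0.
  have := sqr_ge0 e; rewrite mulr1; lra.
have uS : u \notin S by apply: contra uT => /sub_closed_neighborhood.
by rewrite (fS uS) !(mulr0, addr0).
Qed.

End Shift.

Variables (r m B W : R).
Hypothesis conn : connected G.
Hypothesis SV : (#|S| < #|V|)%N.
Hypothesis Sm : #|S|%:R <= m.
Hypothesis m_ge1 : 1 <= m.
Hypothesis TB : \sum_(u in T) (deg G u)%:R <= B.
Hypothesis B_ge1 : 1 <= B.
Hypothesis SW : \sum_(u in S) (deg G u)%:R <= W.
Hypothesis r_le1 : r <= 1.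
Hypothesis rayleighT : forall g, (forall u, u \notin T -> g u = 0) ->
  ip w g (op P g) <= r * ip w g g.

(** This is [e ^+ 2 * B / W] for the shift [e = (4 * m * B)^-1]: the cost of the shift divided by
    the bound [W] on the squared norm of [f]. *)
Definition gap : R := (16 * m ^+ 2 * B * W)^-1.

Lemma rayleigh_gain_normalized f u : (forall v, v \notin S -> f v = 0) ->
  (forall v, 0 <= f v <= 1) -> f u = 1 ->
  ip w f (op P f) <= (r - gap) * ip w f f.
Proof.
move=> fS f01 fu.
have m0 : 0 < m by rewrite (lt_le_trans _ m_ge1).
have B0 : 0 < B by rewrite (lt_le_trans _ B_ge1).
have Q1 : 1 <= ip w f f.
  rewrite /ip (bigD1 u) //= fu !mulr1 -[leLHS]addr0 lerD ?ler1n //.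
  by apply: sumr_ge0 => v _; rewrite mulr_ge0 // -expr2 sqr_ge0.
have QW : ip w f f <= W.
  apply: le_trans SW; rewrite [leRHS]big_mkcond; apply: ler_sum => v _.
  case: ifPn => [_|/fS ->]; last by rewrite mulr0 mulr0.
  rewrite ler_piMr //; have /andP[f0 f1] := f01 v; exact: mulr_ile1.
have W0 : 0 < W by rewrite (lt_le_trans _ QW) // (lt_le_trans _ Q1).
have En : 1 <= m * energy G f.
  apply: le_trans (energy_ge conn SV fS fu) _; rewrite ler_wpM2r //.
  by apply: sumr_ge0 => a _; apply: sumr_ge0 => v _; rewrite mulr_ge0 ?sqr_ge0.
(* Balances the gain [2 * e * (1 - r) * ip w f f] against the cost [e ^+ 2 * B]. *)
pose e := (4 * m * B)^-1.
have e0 : 0 < e by rewrite invr_gt0 !mulr_gt0.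
have En' := energy_shift e fS.
have Qg := ip_shift fS (ltW e0) f01.
move: En'; rewrite !energyE // => En'.
move: En; rewrite energyE // => En.
have := rayleighT (g := fun v => f v + e * (v \in T)%:R).
have gT v : v \notin T -> f v + e * (v \in T)%:R = 0.
  move=> vT; rewrite (negbTE vT) mulr0 addr0 fS //.
  by apply: contra vT => /sub_closed_neighborhood.
move=> /(_ gT); move: En' Qg.
set Qg := ip w _ _; set Xg := ip w _ (op P _) => En' QgE Ray.
move: En En' Q1 QW QgE; set Q := ip w f f; set X := ip w f _ => En En' Q1 QW QgE.
have En2 : Qg - Xg <= (Q - X) + e ^+ 2 * B.
  have : e ^+ 2 * \sum_(u0 in T) (deg G u0)%:R <= e ^+ 2 * B.
    by rewrite ler_wpM2l ?sqr_ge0.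
  lra.
have gQ : gap * Q <= e ^+ 2 * B.
  have -> : e ^+ 2 * B = gap * W.
    by rewrite /e /gap; field; rewrite !gt_eqF.
  by rewrite ler_wpM2l // invr_ge0 !mulr_ge0 // ltW.
have N1 : (1 - r) * ((1 + 2 * e) * Q) <= (1 - r) * Qg.
  by rewrite ler_wpM2l // subr_ge0.
pose i := m^-1.
have i0 : 0 < i by rewrite invr_gt0.
have i1 : i <= 1 by rewrite invf_le1.
have ei : e ^+ 2 * B = e * i / 4 by rewrite /e /i; field; rewrite !gt_eqF.
have e4 : e <= i / 4.
  have -> : e = i / 4 * B^-1 by rewrite /e /i; field; rewrite !gt_eqF.
  by rewrite ler_piMr ?invf_le1 // divr_ge0 // ltW.
have EX : i <= 2 * (Q - X).
  by rewrite -[i]mul1r ler_pdivrMr // mulrC.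
have ei4 : e * i <= i / 4.
  have : e * i <= 1 / 4 * i by rewrite ler_wpM2r ?(ltW i0) //; lra.
  lra.
(* If the bound failed, [EX] would force [(1 - r) * Q] to be at least [i / 4]. The gain
   [2 * e * (1 - r) * Q] would then be at least [2 * e ^+ 2 * B], whereas [Ray], [N1], [En2], [gQ]
   and [H] make it strictly smaller. *)
rewrite leNgt; apply/negP => H.
have N2 : i / 4 <= (1 - r) * Q by lra.
have N3 : e * (i / 4) <= e * ((1 - r) * Q) by rewrite ler_wpM2l // ltW.
lra.
Qed.

(** Passing to [|h|] keeps the norm and can only increase the form, as the adjacency entries are
    nonnegative. So the bottom of the spectrum is controlled too, and dividing by the maximum
    reduces to the normalized case. *)
Lemma rayleigh_gain h : (forall v, v \notin S -> h v = 0) ->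
  `|ip w h (op P h)| <= (r - gap) * ip w h h.
Proof.
move=> hS.
have [h0|] := eqVneq (ip w h h) 0.
  by have := ip_step_le deg_gt0 h; rewrite h0 !mulr0.
move=> h0.
have [u0 hu0] : exists u, h u != 0.
  apply/existsP; apply: contraR h0; rewrite negb_exists => /forallP h0.
  apply/eqP; apply: big1 => u _.
  by have := h0 u; rewrite negbK => /eqP ->; rewrite mulr0 mulr0.
pose u := [arg max_(v > u0) `|h v|]%O.
have hu v : `|h v| <= `|h u|.
  by rewrite /u; case: Order.TotalTheory.arg_maxP => // z _; apply.
have M0 : 0 < `|h u| by rewrite (lt_le_trans _ (hu u0)) // normr_gt0.
set M := `|h u| in hu M0.
pose f v := `|h v| / M.
have hf v : `|h v| = M * f v by rewrite /f mulrC divfK // gt_eqF.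
have fgain : ip w f (op P f) <= (r - gap) * ip w f f.
  apply: (@rayleigh_gain_normalized f u).
  - by move=> v /hS; rewrite /f => ->; rewrite normr0 mul0r.
  - move=> v; rewrite /f divr_ge0 ?(ltW M0) //=.
    by rewrite ler_pdivrMr // mul1r.
  - by rewrite /f divff // gt_eqF.
have -> : ip w h h = M ^+ 2 * ip w f f.
  rewrite mulr_sumr; apply: eq_bigr => v _.
  by rewrite -expr2 -real_normK ?num_real // hf; ring.
apply: (@le_trans _ _ (M ^+ 2 * ip w f (op P f))); last first.
  by rewrite [leRHS]mulrCA ler_wpM2l ?sqr_ge0.
rewrite !ip_step // mulr_sumr.
apply: le_trans (ler_norm_sum _ _ _) _; apply: ler_sum => a _.
apply: le_trans (ler_norm_sum _ _ _) _; rewrite mulr_sumr; apply: ler_sum => v _.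
by rewrite !normrM !hf ger0_norm // le_eqVlt; apply/orP; left; apply/eqP; ring.
Qed.

(** Tested on a point mass; the sign is needed to raise the bound to powers. *)
Lemma gap_gain_ge0 x : x \in S -> 0 <= r - gap.
Proof.
move=> xS; have := @rayleigh_gain (delta R x).
have dS v : v \notin S -> delta R x v = 0.
  by rewrite /delta; case: eqP => // ->; rewrite xS.
move=> /(_ dS) /(le_trans (normr_ge0 _)).
by rewrite ip_deltal /delta eqxx mulr1 pmulr_lge0 // ltr0n.
Qed.

Lemma restricted_return_le x k : x \in S ->
  iter (2 * k) (op (restricted_step R G S)) (delta R x) x <= (r - gap) ^+ (2 * k).
Proof.
move=> xS.
have dx : 0 < (deg G x)%:R :> R by rewrite ltr0n.
have rev := restricted_step_reversible R deg_gt0 S.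
rewrite -(ler_pM2l dx) -(ip_iter_op_return rev).
apply: le_trans (ip_iter_op_le (l := r - gap) rev _ _ _ _) _.
- exact: gap_gain_ge0 xS.
(* The form of the restricted kernel at [h] is that of [P] at the truncation of [h] to [S]. *)
- move=> h; pose hS u := if u \in S then h u else 0.
  have -> : ip w h (op (restricted_step R G S) h) = ip w hS (op P hS).
    rewrite !ip_op; apply: eq_bigr => u _; apply: eq_bigr => v _.
    rewrite /restricted_step /hS; case: (u \in S); case: (v \in S) => //=;
      by rewrite ?(mulr0, mul0r).
  apply: le_trans (rayleigh_gain _) _; first by move=> v /negbTE vS; rewrite /hS vS.
  rewrite ler_wpM2l ?(gap_gain_ge0 xS) //; apply: ler_sum => u _.
  rewrite ler_wpM2l // /hS; case: ifP => // _.
  by rewrite mul0r -expr2 sqr_ge0.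
by rewrite ip_deltal /delta eqxx mulr1 mulrC.
Qed.

End Gain.

(** * Exponential decay of returns confined to a small set *)

Section Return.
Variables (R : realType) (V : finType) (G : multigraph V).
Hypothesis deg_gt0 : forall u, (0 < deg G u)%N.
Hypothesis conn : connected G.

Local Notation P := (step_prob R G).
Local Notation ret k y := (iter (2 * k) (op P) (delta R y) y).
Local Notation D := (max_degree G).

Lemma restricted_return_decay (S T : {set V}) (m B W C : R) x k :
  (forall u v, u \in S -> lazy_neighbor G u v -> v \in T) ->
  (#|S| < #|V|)%N -> #|S|%:R <= m -> 1 <= m ->
  \sum_(u in T) (deg G u)%:R <= B -> 1 <= B ->
  \sum_(u in S) (deg G u)%:R <= W -> 0 <= W ->
  (0 < k)%N -> 0 <= C -> \sum_(y in T) ret k y <= C -> x \in S ->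
  iter (2 * k) (op (restricted_step R G S)) (delta R x) x <=
  C * expR (- ((2 * k)%:R * gap m B W)).
Proof.
move=> ST SV Sm m1 TB B1 SW W0 k0 C0 TC xS.
have k20 : (0 < 2 * k)%N by rewrite muln_gt0.
(* With this root of the trace bound, [rayleigh_le] applies on [T]; the cap at 1 below is justified
   by [ip_step_le]. *)
pose r0 := C `^ (2 * k)%:R^-1.
have r00 : 0 <= r0 by apply: powR_ge0.
have r0C : r0 ^+ (2 * k) = C by apply: powR_rootK.
pose r := Num.min 1 r0.
have r1 : r <= 1 by rewrite /r ge_min lexx.
have r_ge0 : 0 <= r by rewrite /r le_min ler01.
have rC : r ^+ (2 * k) <= C.
  by rewrite -[leRHS]r0C lerXn2r ?nnegrE // /r ge_min lexx orbT.
have ray g : (forall u, u \notin T -> g u = 0) ->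
    ip (fun u : V => (deg G u)%:R : R) g (op P g) <=
    r * ip (fun u : V => (deg G u)%:R : R) g g.
  move=> gT; rewrite /r; case: (leP 1 r0) => _.
    exact: le_trans (ler_norm _) (ip_step_le deg_gt0 g).
  by apply: (rayleigh_le deg_gt0 r00 k0 _ gT); rewrite r0C.
apply: le_trans (restricted_return_le deg_gt0 ST conn SV Sm m1 TB B1 SW r1 ray k xS) _.
have rg := gap_gain_ge0 deg_gt0 ST conn SV Sm m1 TB B1 SW r1 ray xS.
have g0 : 0 <= gap m B W by rewrite invr_ge0 !mulr_ge0 // (le_trans ler01).
rewrite -mulrN expRM_natl.
apply: (@le_trans _ _ ((r * expR (- gap m B W)) ^+ (2 * k))).
  rewrite lerXn2r ?nnegrE ?mulr_ge0 ?expR_ge0 //.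
  (* As [r <= 1], the additive gap is also a multiplicative one. *)
  apply: (@le_trans _ _ (r * (1 - gap m B W))).
    by rewrite mulrBr mulr1 lerD2l lerN2 ler_piMl.
  by rewrite ler_wpM2l // expR_ge1Dx.
by rewrite exprMn ler_wpM2r // exprn_ge0 // expR_ge0.
Qed.

Lemma return_in_support_le x m k (t : (2 * m).-tuple V) :
  (2 <= D)%N -> (0 < m < #|V|)%N -> (0 < k)%N ->
  path (lazy_neighbor G) x t -> (#|[set v | v \in x :: t]| <= m)%N ->
  iter (2 * k) (op (restricted_step R G [set v | v \in x :: t])) (delta R x) x <=
  D%:R ^+ (8 * m) * ret k x * expR (- (k%:R / (16 * D%:R ^+ 3 * m%:R ^+ 4))).
Proof.
move=> D2 /andP[m0 mV] k0 pt; set S := [set v | v \in x :: t] => Sm.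
pose T := \bigcup_(u in S) [set v | lazy_neighbor G u v].
have ST u v : u \in S -> lazy_neighbor G u v -> v \in T.
  by move=> uS uv; apply/bigcupP; exists u => //; rewrite inE.
have D2R : 2 <= D%:R :> R by rewrite ler_nat.
have D1R : 1 <= D%:R :> R by rewrite (le_trans _ D2R) // ler1n.
have D0R : 0 <= D%:R :> R by [].
have m1R : 1 <= m%:R :> R by rewrite ler1n.
have cardT : (#|T| <= m * D.+1)%N.
  by apply: leq_trans (card_neighborhood _ _) _; rewrite leq_mul2r Sm orbT.
have cardTR : #|T|%:R <= 2 * D%:R * m%:R :> R.
  apply: (@le_trans _ _ (m * D.+1)%:R); first by rewrite ler_nat.
  rewrite natrM mulrC ler_wpM2r // -natr1; lra.
have sumdeg (A : {set V}) : \sum_(u in A) (deg G u)%:R <= D%:R * #|A|%:R :> R.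
  rewrite mulr_natr -sumr_const; apply: ler_sum => u _.
  by rewrite ler_nat deg_le_max.
pose B : R := 2 * D%:R ^+ 2 * m%:R; pose W : R := D%:R * m%:R.
(* A factor [D ^+ 2] per step: at most [2 * m] steps along [t], then one step from [S] into [T]. *)
have retT y : y \in T -> ret k y <= D%:R ^+ (4 * m + 2) * ret k x.
  move=> /bigcupP[u]; rewrite !inE => xu uy.
  case: k k0 => // k' _.
  have uyp : path (lazy_neighbor G) u [:: y] by rewrite /= uy.
  have yin : y \in [:: u; y] by rewrite !inE eqxx orbT.
  apply: le_trans (ret_lazy_path R deg_gt0 k' uyp yin) _.
  rewrite [size _]/= addnC exprD -mulrA ler_wpM2l ?exprn_ge0 //.
  have xu' : u \in x :: t by rewrite inE.
  apply: le_trans (ret_lazy_path R deg_gt0 k' pt xu') _.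
  by rewrite size_tuple mulnA.
have m2 : 2 * m%:R <= D%:R ^+ m :> R.
  apply: (@le_trans _ _ (2 ^+ m)); last by rewrite lerXn2r ?nnegrE.
  rewrite -natrX -natrM ler_nat -(prednK m0) expnS leq_mul2l /=.
  exact: ltn_expl.
have rx0 : 0 <= ret k x by apply: ret_ge0.
have TC : \sum_(y in T) ret k y <= D%:R ^+ (8 * m) * ret k x.
  apply: (@le_trans _ _ (\sum_(y in T) D%:R ^+ (4 * m + 2) * ret k x)).
    by apply: ler_sum => y /retT.
  rewrite sumr_const -[leLHS]mulr_natl mulrA ler_wpM2r //.
  (* The cardinality of [T] is at most [2 * D * m], hence at most [D ^+ (m + 1)]; the total exponent
     [5 * m + 3] is at most [8 * m] since [m] is positive. *)
  apply: (@le_trans _ _ (D%:R ^+ (m + 1) * D%:R ^+ (4 * m + 2))).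
    rewrite ler_wpM2r ?exprn_ge0 // (le_trans cardTR) //.
    by rewrite mulrAC exprD expr1 ler_wpM2r.
  rewrite -exprD ler_weXn2l //; lia.
have := @restricted_return_decay S T m%:R B W (D%:R ^+ (8 * m) * ret k x) x k ST.
have -> : (2 * k)%:R * gap m%:R B W = k%:R / (16 * D%:R ^+ 3 * m%:R ^+ 4).
  rewrite /gap /B /W natrM; field.
  by rewrite !gt_eqF // (lt_le_trans ltr01).
apply => //.
- exact: leq_ltn_trans Sm mV.
- by rewrite ler_nat.
- apply: le_trans (sumdeg T) _; apply: le_trans (ler_wpM2l D0R cardTR) _.
  by rewrite le_eqVlt /B; apply/orP; left; apply/eqP; ring.
- by rewrite /B mulr_ege1 // mulr_ege1 ?exprn_ege1 // ler1n.
- by apply: le_trans (sumdeg S) _; rewrite ler_wpM2l // ler_nat.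
- by rewrite mulr_ge0.
- by rewrite mulr_ge0 // exprn_ge0.
by rewrite !inE eqxx.
Qed.

End Return.

(** * Numerical estimates and the final bound *)

Lemma exponent_bound (R : realType) (D m s : R) (j k : nat) : j%:R = m ->
  2 <= D -> 1 <= m -> m <= s ->
  1024 * m ^+ 5 * (D ^+ 7 * ln D) <= k%:R ->
  D ^+ (12 * j) * expR (- (k%:R / (16 * D ^+ 3 * m ^+ 4))) <=
  expR (- (k%:R / (65 * D ^+ 7 * s ^+ 4))).
Proof.
move=> jm D2 m1 ms Hk.
have D0 : 0 < D by rewrite (lt_le_trans _ D2).
have m0 : 0 < m by rewrite (lt_le_trans _ m1).
have s0 : 0 < s by rewrite (lt_le_trans _ ms).
have -> : D ^+ (12 * j) = expR (12 * (m * ln D)).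
  by rewrite -{1}(lnK (x := D)) ?posrE // -expRM_natl natrM jm mulrA.
rewrite -expRD ler_expR.
(* In units of [Y], the entropy term is at most [12 / 1024], the decay is at least 1 because
   [D ^+ 4 >= 16], and the target is at most [1 / 65]. *)
pose Y := k%:R / (D ^+ 7 * m ^+ 4).
have Dm0 : 0 < D ^+ 7 * m ^+ 4 by rewrite mulr_gt0 ?exprn_gt0.
have Y0 : 0 <= Y by rewrite divr_ge0 // ltW.
have HY : 1024 * (m * ln D) <= Y.
  by rewrite ler_pdivlMr //; apply: le_trans Hk; rewrite le_eqVlt;
    apply/orP; left; apply/eqP; ring.
have e1 : k%:R / (16 * D ^+ 3 * m ^+ 4) = D ^+ 4 / 16 * Y.
  by rewrite /Y; field; rewrite !gt_eqF.
have D4 : 1 <= D ^+ 4 / 16.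
  rewrite ler_pdivlMr // mul1r; have -> : 16 = 2 ^+ 4 :> R by ring.
  by rewrite lerXn2r ?nnegrE // ltW.
have e2 : Y <= D ^+ 4 / 16 * Y by rewrite ler_peMl.
have e3 : k%:R / (65 * D ^+ 7 * s ^+ 4) <= Y / 65.
  have -> : Y / 65 = k%:R / (65 * D ^+ 7 * m ^+ 4).
    by rewrite /Y; field; rewrite !gt_eqF.
  rewrite ler_wpM2l // lef_pV2 ?posrE ?mulr_gt0 ?exprn_gt0 //.
  by rewrite ler_wpM2l ?mulr_ge0 ?exprn_ge0 ?(ltW D0) // lerXn2r ?nnegrE // ltW.
rewrite e1; lra.
Qed.

Lemma connected_deg_gt0 (V : finType) (G : multigraph V) :
  connected G -> (1 < #|V|)%N -> forall u, (0 < deg G u)%N.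
Proof.
move=> conn V1 u.
have [v vu] : exists v, v != u.
  apply/existsP; rewrite -negb_forall; apply/negP => /forallP all.
  move: V1; rewrite ltnNge => /negP; apply.
  rewrite -(cards1 u) -cardsT subset_leq_card //; apply/subsetP => v _.
  by have := all v; rewrite inE.
have /connectP[[|z p] /= pp ev] := conn u v; first by rewrite ev eqxx in vu.
by case/andP: pp => uz _; rewrite /deg (bigD1 z) //= addn_gt0 uz.
Qed.

(** From [ln y <= y - 1] at [y = a^-1]. *)
Lemma ln_ge_half (R : realType) (a : R) : 2 <= a -> 1 / 2 <= ln a.
Proof.
move=> a2; have a0 : 0 < a by rewrite (lt_le_trans _ a2).
have ai : a^-1 <= 2^-1 by rewrite lef_pV2 ?posrE.
have ai0 : 0 < a^-1 by rewrite invr_gt0.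
have h : -1 < a^-1 - 1 by lra.
have := le_ln1Dx h; rewrite addrC subrK lnV ?posrE //; lra.
Qed.

Theorem theorem1p3 (R : realType) (V : finType) (G : multigraph V)
    (n Delta k : nat) (x : V) (s : R)
    (hconn : connected G) (hn : #|V| = n) (hDelta : max_degree G = Delta)
    (hk : (1 <= k)%N) (hkn : (2 * k < n)%N)
    (hs0 : 0 < s)
    (hs : s <= 4^-1 * (k%:R / (Delta%:R ^+ 7 * ln Delta%:R)) `^ (5^-1)) :
  walk_cond_prob R G x (2 * k)
    (fun g => (support_size g)%:R <= s)
    (fun g => nth x g (2 * k) == nth x g 0)
  <= expR (- (k%:R / (65 * Delta%:R ^+ 7 * s ^+ 4))).
Proof.
have V1 : (1 < #|V|)%N by rewrite hn; apply: leq_ltn_trans hkn; lia.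
have deg_gt0 := connected_deg_gt0 hconn V1.
have D1 : (1 <= Delta)%N by rewrite -hDelta (leq_trans (deg_gt0 x)) // deg_le_max.
have D2 : (2 <= Delta)%N.
  (* For [Delta = 1] the logarithm vanishes and its inverse is 0 by convention, so [hs] would
     contradict [0 < s]. *)
  rewrite ltn_neqAle D1 andbT; apply/eqP => D1'; move: hs.
  rewrite -D1' ln1 mulr0 invr0 mulr0 powR0 ?mulr0 ?invr_eq0 ?pnatr_eq0 //.
  by rewrite leNgt hs0.
have D2R : 2 <= Delta%:R :> R by rewrite ler_nat.
have D0R : 0 < Delta%:R :> R by rewrite (lt_le_trans _ D2R).
have lnD := ln_ge_half D2R.
have DL0 : 0 < Delta%:R ^+ 7 * ln Delta%:R :> R.
  by rewrite mulr_gt0 ?exprn_gt0 //; lra.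
have sk : 1024 * s ^+ 5 * (Delta%:R ^+ 7 * ln Delta%:R) <= k%:R.
  rewrite -ler_pdivlMr //.
  have Y0 : 0 <= k%:R / (Delta%:R ^+ 7 * ln Delta%:R) :> R.
    by rewrite mulr_ge0 ?invr_ge0 ?(ltW DL0).
  rewrite -[leRHS](powR_rootK (n := 5) Y0) //.
  have -> : 1024 * s ^+ 5 = (4 * s) ^+ 5 by ring.
  rewrite lerXn2r ?nnegrE ?powR_ge0 ?mulr_ge0 ?(ltW hs0) //; lra.
pose m := Num.truncn s.
have ms : m%:R <= s by rewrite truncn_le ltW.
rewrite /walk_cond_prob closed_walk_prob.
set q := iter _ _ _ _; set num := walk_prob _ _ _ _ _.
have q0 : 0 <= q by apply: ret_ge0.
(* A null conditioning event gives conditional probability 0, as division by 0 yields 0. *)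
have [q00|q00] := eqVneq q 0; first by rewrite q00 invr0 mulr0 expR_ge0.
have qp : 0 < q by rewrite lt_neqAle eq_sym q00.
rewrite ler_pdivrMr //.
have suppm (g : seq V) : (support_size g)%:R <= s -> (support_size g <= m)%N.
  by move=> gs; rewrite truncn_ge_nat // ltW.
(* If [m = 0] the event is empty, since the support contains [x]. *)
clearbody m; have [m0|m0] := posnP m.
  rewrite /num /walk_prob big_pred0 ?mulr_ge0 ?expR_ge0 // => t.
  apply/negP => /andP[/= /suppm]; rewrite m0 leqn0 cards_eq0 => /eqP s0 _.
  by have := in_set0 x; rewrite -s0 !inE eqxx.
have m1R : 1 <= m%:R :> R by rewrite ler1n.
have mk : 1024 * m%:R ^+ 5 * (Delta%:R ^+ 7 * ln Delta%:R) <= k%:R :> R.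
  apply: le_trans sk; rewrite ler_pM2r // ler_pM2l // lerXn2r ?nnegrE //.
  exact: ltW.
(* With [2 * k < n] this leaves a vertex outside every set of at most [m] vertices, as exit paths
   require. *)
have m_le_k : (m <= k)%N.
  rewrite -(ler_nat R); apply: le_trans mk.
  have d7 : 1 <= Delta%:R ^+ 7 :> R by rewrite exprn_ege1 // ler1n.
  have d7l : 1 / 2 <= Delta%:R ^+ 7 * ln Delta%:R :> R.
    by rewrite (le_trans lnD) // ler_peMl // (le_trans _ lnD) // divr_ge0.
  have m5 : m%:R <= m%:R ^+ 5 :> R by rewrite -[leLHS]expr1 ler_weXn2l.
  apply: (@le_trans _ _ (1024 * m%:R ^+ 5 * (1 / 2))).
    by move: (m%:R : R) (m%:R ^+ 5) m1R m5 => a b; lra.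
  by rewrite ler_wpM2l // mulr_ge0 // exprn_ge0.
have mV : (m < #|V|)%N 
  by rewrite hn (leq_ltn_trans m_le_k) // (leq_ltn_trans _ hkn) // leq_pmull.
have D2' : (2 <= max_degree G)%N by rewrite hDelta.
have m0V : (0 < m < #|V|)%N by rewrite m0 mV.
pose c : R := expR (- (k%:R / (16 * Delta%:R ^+ 3 * m%:R ^+ 4))).
have b0 : 0 <= Delta%:R ^+ (8 * m) * q * c.
  by rewrite !mulr_ge0 ?exprn_ge0 ?expR_ge0.
have bnd (t : (2 * m).-tuple V) : path (lazy_neighbor G) x t ->
    (#|[set v | v \in x :: t]| <= m)%N ->
    iter (2 * k) (op (restricted_step R G [set v | v \in x :: t])) (delta R x) x
    <= Delta%:R ^+ (8 * m) * q * c.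
  by move=> pt tm; have := return_in_support_le R deg_gt0 hconn D2' m0V hk pt tm;
    rewrite hDelta.
have ub := small_support_union_bound
  (E := fun g : seq V => (support_size g)%:R <= s) suppm b0 bnd.
apply: (le_trans ub).
rewrite hDelta natrX.
(* The number of lazy walks is absorbed through [Delta + 1 <= Delta ^ 2], valid as [Delta >= 2]. *)
apply: (@le_trans _ _ (Delta%:R ^+ (4 * m) * (Delta%:R ^+ (8 * m) * q * c))).
  rewrite ler_wpM2r // (_ : (4 * m = 2 * (2 * m))%N); last by rewrite mulnA.
  rewrite [leRHS]exprM lerXn2r ?nnegrE ?exprn_ge0 //.
  rewrite -natrX ler_nat -mulnn (leq_trans _ (leq_mul D2 (leqnn _))) //.
  by rewrite mul2n -addnn -addn1 leq_add2l.
have -> : Delta%:R ^+ (4 * m) * (Delta%:R ^+ (8 * m) * q * c) =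
    Delta%:R ^+ (12 * m) * c * q.
  by rewrite (_ : (12 * m = 4 * m + 8 * m)%N) ?exprD; [ring|rewrite -mulnDl].
by rewrite ler_wpM2r //; apply: exponent_bound.
Qed.
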